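(* Let $G$ be a (topologically) finitely generated prosolvable group. If there exists $\gamma\in\mathbb N$ such that $\dim_{\operatorname{End}_G(V)}V\le\gamma$ for every irreducible $G$-module $V$ which is $G$-isomorphic to a complemented chief factor of $G$, then $c_n(G)$ is polynomially bounded, i.e. there exists $\beta$, independent of $n$, such that $c_n(G)\le n^\beta$ for every positive integer $n$.
   Context: $c_n(G)$ denotes the number of open subgroups of $G$ of index $n$ which are intersections of (open) maximal subgroups of $G$. A chief factor of $G$ means a chief factor $X/Y$ with $X,Y$ open normal subgroups of $G$; it is complemented if $X/Y$ has a complement in $G/Y$. It is regarded as an irreducible $G$-module under conjugation. *)

(* Defs.v *)
From HB Require Import structures.
From mathcomp Require Import all_boot all_order all_algebra all_fingroup.
From mathcomp Require Import all_solvable.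
From mathcomp Require Import boolp classical_sets functions cardinality.
From mathcomp Require Import topology.

Set Implicit Arguments.
Unset Strict Implicit.
Unset Printing Implicit Defensive.

Local Open Scope classical_set_scope.
Local Open Scope card_scope.
Local Open Scope group_scope.

HB.structure Definition PreTopologicalGroup := {G of Topological G & monoid.Group G}.

HB.mixin Record PreTopologicalGroup_isTopologicalGroup G
    & PreTopologicalGroup G := {
  mulg_continuous : continuous (fun x : G * G => x.1 * x.2) ;
  invg_continuous : continuous (fun x : G => x^-1)
}.

#[short(type="topologicalGroupType")]
HB.structure Definition TopologicalGroup :=
  {G of PreTopologicalGroup G & PreTopologicalGroup_isTopologicalGroup G}.

Section GroupSets.
Variable G : groupType.
Implicit Types (A B H K N X Y : set G) (x g : G).

Definition is_subgroup H : Prop := group_closed [in H].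

Definition is_normal N : Prop :=
  is_subgroup N /\ forall x g, N x -> N (x ^ g).

Definition setmul A B : set G := [set x * y | x in A & y in B].

Definition setconj A g : set G := [set x ^ g | x in A].

(* X / H is the set of the right cosets H * x with x in X; it is used both for
   the cosets of an arbitrary subgroup H (with X = setT) and, with the product
   setmul, for the group X/Y when Y is a normal subgroup *)
Definition cosets X H : set (set G) := [set setmul H [set x] | x in X].

Definition has_index H (n : nat) : Prop := cosets [set: G] H #= `I_n.

(* the group G/N, with N normal, is finite and solvable *)
Definition solvable_quotient N : Prop :=
  exists (gT : finGroupType) (phi : set G -> gT),
    [/\ set_bij (cosets [set: G] N) [set: gT] phi,
        forall A B, cosets [set: G] N A -> cosets [set: G] N B ->
          phi (setmul A B) = phi A * phi B
      & solvable [set: gT]%SET].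

End GroupSets.

Section TopologicalGroups.
Variable G : topologicalGroupType.
Implicit Types H K M N X Y : set G.

Definition open_subgroup H : Prop := open H /\ is_subgroup H.

Definition open_normal N : Prop := open N /\ is_normal N.

Definition profinite : Prop :=
  [/\ compact [set: G], hausdorff_space G & totally_disconnected [set: G]].

Definition prosolvable : Prop :=
  profinite /\ forall N, open_normal N -> solvable_quotient N.

Definition top_fin_generated : Prop :=
  exists S : set G,
    finite_set S /\ closure (smallest (@is_subgroup G) S) = [set: G].

Definition open_maximal M : Prop :=
  [/\ open_subgroup M, M <> [set: G]
    & forall K, is_subgroup K -> M `<=` K -> K = M \/ K = [set: G]].

(* c_n(G) is the cardinal of this set; the empty family is allowed, so that
   the whole group, of index 1, is always counted *)
Definition max_intersections (n : nat) : set (set G) :=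
  [set H | [/\ open_subgroup H, has_index H n
     & exists F : set (set G),
         F `<=` open_maximal /\ H = \bigcap_(M in F) M]].

(* normal subgroups lying between X and Y are automatically open *)
Definition open_chief_factor X Y : Prop :=
  [/\ open_normal X, open_normal Y, Y `<` X
    & forall N, is_normal N -> Y `<=` N -> N `<=` X -> N = Y \/ N = X].

(* by the correspondence theorem, the subgroups of G/Y are the quotients K/Y
   with K a subgroup of G containing Y; the subgroup of G/Y with underlying
   set cosets K Y is a complement of X/Y in G/Y *)
Definition complemented X Y : Prop :=
  exists K, [/\ is_subgroup K, Y `<=` K,
    cosets K Y `&` cosets X Y = [set Y]
  & [set setmul A B | A in cosets K Y & B in cosets X Y]
      = cosets [set: G] Y].

End TopologicalGroups.

Arguments max_intersections : clear implicits.

Section GModules.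
Local Open Scope ring_scope.

(* G acts on the right, in accordance with conjugation x ^ g = g^-1 * x * g *)
Record gmodule (G : groupType) := GModule {
  gmod_sort :> zmodType ;
  gmod_act : gmod_sort -> G -> gmod_sort ;
  gmod_actD : forall u v g, gmod_act (u + v) g = gmod_act u g + gmod_act v g ;
  gmod_act1 : forall v, gmod_act v 1%g = v ;
  gmod_actM : forall v g h, gmod_act v (g * h)%g = gmod_act (gmod_act v g) h
}.

Variables (G : groupType) (V : gmodule G).

Definition gmod_irreducible : Prop :=
  (exists v : V, v <> 0) /\
  forall W : set V, zmod_closed [in W] ->
    (forall v g, W v -> W (gmod_act v g)) -> W = [set 0] \/ W = [set: V].

(* the ring End_G(V), acting on V by evaluation *)
Definition endG : set {additive V -> V} :=
  [set f | forall v g, f (gmod_act v g) = gmod_act (f v) g].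

Definition endG_basis (k : nat) (b : 'I_k -> V) : Prop :=
  (forall v : V, exists e : 'I_k -> {additive V -> V},
     (forall i, endG (e i)) /\ v = \sum_(i < k) e i (b i)) /\
  (forall e : 'I_k -> {additive V -> V},
     (forall i, endG (e i)) -> \sum_(i < k) e i (b i) = 0 ->
     forall i v, e i v = 0).

(* V is a k-dimensional vector space over End_G(V), which is a division ring
   when V is irreducible; an infinite-dimensional V satisfies this for no k *)
Definition endG_dim (k : nat) : Prop := exists b : 'I_k -> V, endG_basis b.

(* G-isomorphism between the section X/Y, under conjugation, and V *)
Definition gmod_isom_section (X Y : set G) : Prop :=
  exists phi : set G -> V,
    [/\ set_bij (cosets X Y) [set: V] phi,
        forall A B, cosets X Y A -> cosets X Y B ->
          phi (setmul A B) = phi A + phi B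
      & forall A g, cosets X Y A -> phi (setconj A g) = gmod_act (phi A) g].

End GModules.

(* Main.v *)
(* Everything happens in finite solvable quotients Q of G. Fix a chief series of
   Q. A maximal subgroup M complements exactly one factor V = U/W of the series,
   and M is the zero set of a derivation Q -> V. If E = End_Q(V) and V = E^k with
   k <= gamma, then:
   - M is encoded, up to isomorphism of V, by k, the minimal polynomial of a
     generator of the finite field E, and the coordinates of the action and of
     the derivation on d generators of Q; hence Q has at most n^c1 maximal
     subgroups of index n, with c1 independent of Q;
   - in an irredundant family of maximal subgroups, those complementing V have
     E-linearly independent derivations, which are determined by their values at
     the generators, so there are at most k d of them.
   Since |H U : H W| = |V| as soon as some M containing H complements V, an
   irredundant intersection H of maximal subgroups M_i satisfies
   prod |Q : M_i| <= |Q : H|^(gamma d), and Rankin's trick bounds the number of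
   such families. *)
From HB Require Import structures.
Require Import Defs.
From mathcomp Require Import all_boot all_order all_algebra all_fingroup.
From mathcomp Require Import all_solvable finfield mxrepresentation mxabelem.
From mathcomp Require Import boolp lra ring.

Set Implicit Arguments.
Unset Strict Implicit.
Unset Printing Implicit Defensive.

Import Order.TTheory GRing.Theory Num.Theory.
Local Open Scope ring_scope.

(** * Centralizers and derivations *)

Section Centralizer.
Variables (F : finFieldType) (n : nat) (I : finType) (rho : I -> 'M[F]_n.+1).

(** For a representation [rho] this is the ring [E] of endomorphisms, acting on row vectors from the
    right. *)
Definition mxcent : {pred 'M[F]_n.+1} :=
  [pred A | [forall g, A * rho g == rho g * A]].

Lemma mxcentP A : reflect (forall g, GRing.comm A (rho g)) (A \in mxcent).
Proof. exact: 'forall_eqP. Qed.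

Lemma mxcent_divring_closed : divring_closed mxcent.
Proof.
split=> [|A B /mxcentP cA /mxcentP cB|A B /mxcentP cA /mxcentP cB].
- by apply/mxcentP=> g; apply/commr_sym/commr1.
- by apply/mxcentP=> g; apply/commr_sym/commrB; apply/commr_sym.
- by apply/mxcentP=> g; apply/commr_sym/commrM; [|apply/commrV]; apply/commr_sym.
Qed.

HB.instance Definition _ := GRing.isDivringClosed.Build _ mxcent
  mxcent_divring_closed.

Record mxcent_ring := MxCent { mxcent_val :> 'M[F]_n.+1; _ : mxcent_val \in mxcent }.
HB.instance Definition _ := [isSub for mxcent_val].
HB.instance Definition _ := [Finite of mxcent_ring by <:].
HB.instance Definition _ := [SubChoice_isSubUnitRing of mxcent_ring by <:].

(** The centralizer is a finite division ring, hence commutative by Wedderburn's theorem, and its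
    group of units is cyclic. With [a] a generator, every nonzero element is a power of [a], hence a
    polynomial in [a]. *)
Lemma mxcent_primitive :
    {in mxcent, forall A, A != 0 -> A \in unitmx} ->
  exists2 a, a \in mxcent &
    forall A, A \in mxcent -> exists P, A = horner_mx a P.
Proof.
move=> unitE.
have unitR (x : mxcent_ring) : x != 0 -> x \is a GRing.unit.
  by move=> nzx; apply: unitE (valP x) _.
have domR (x y : mxcent_ring) : x * y = 0 -> (x == 0) || (y == 0).
  move=> xy0; apply: contra_eqT xy0 => /norP[/unitR Ux /unitR Uy].
  by apply: contraTneq (Ux) => xy0; rewrite -(unitrMl _ Uy) xy0 unitr0.
have comR := finDomain_mulrC domR.
have cycU : cyclic [set: {unit mxcent_ring}].
  apply: (@div_ring_mul_group_cyclic _ _ _ (fun u : {unit mxcent_ring} => val u)) => //.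
    move=> u; rewrite !inE andbT => u1; apply: unitR.
    by rewrite subr_eq0 -(inj_eq val_inj) in u1 *.
  by apply/centsP=> u _ v _; apply: val_inj; apply: comR.
have /cyclicP[a defU] := cycU.
exists (val (val a)) => [|A cA]; first exact: valP.
have [->|nzA] := eqVneq A 0; first by exists 0; rewrite rmorph0.
have UA : (MxCent cA) \is a GRing.unit by apply: unitR; rewrite -(inj_eq val_inj).
have : FinRing.unit mxcent_ring UA \in <[a]>%g by rewrite -defU inE.
case/cycleP=> i /(congr1 (fun u : {unit mxcent_ring} => val (val u))) /= ->.
exists ('X^i); rewrite rmorphXn /= horner_mx_X.
by elim: i => // i IH; rewrite expgS exprS -IH.
Qed.
End Centralizer.

Section Cocycles.
Variables (gT : finGroupType) (F : finFieldType) (n : nat).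
Variable rho : mx_representation F [set: gT]%G n.+1.

(** Only the values of [b] below [k] matter. Indexing by [nat] keeps the type of [b] independent of
    [k], which is later read off from a code. *)
Definition mxcent_basis (k : nat) (b : nat -> 'rV[F]_n.+1) : Prop :=
  (forall v, exists2 e : nat -> 'M[F]_n.+1,
     forall i, e i \in mxcent rho & v = \sum_(i < k) b i *m e i) /\
  (forall e : nat -> 'M[F]_n.+1, (forall i, e i \in mxcent rho) ->
     \sum_(i < k) b i *m e i = 0 -> forall i, (i < k)%N -> e i = 0).

Definition mxcent_dim_le (m : nat) : Prop :=
  exists k b, (k <= m)%N /\ mxcent_basis k b.

(** A derivation, or crossed homomorphism, for the right action. *)
Definition cocycle (D : gT -> 'rV[F]_n.+1) : Prop :=
  forall g h, D (g * h)%g = D g *m rho h + D h.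

Lemma cocycle1 D : cocycle D -> D 1%g = 0.
Proof.
move=> cD; have := cD 1%g 1%g; rewrite mulg1 repr_mx1 mulmx1 => /esym/eqP.
by rewrite -subr_eq0 addrK => /eqP.
Qed.

(** The zero set of a derivation is a subgroup. *)
Lemma cocycle_gen_eq0 D (A : {set gT}) :
  cocycle D -> <<A>>%g = [set: gT] -> {in A, forall x, D x = 0} -> D =1 fun=> 0.
Proof.
move=> cD genA DA g.
pose K := [set x | D x == 0].
have gK : group_set K.
  apply/group_setP; split=> [|x y]; first by rewrite inE cocycle1.
  by rewrite !inE cD => /eqP-> /eqP->; rewrite mul0mx addr0.
have : <<A>>%g \subset Group gK.
  by rewrite gen_subG; apply/subsetP=> x /DA; rewrite inE => ->.
by rewrite genA => /subsetP/(_ g (in_setT g)); rewrite inE => /eqP.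
Qed.

Hypothesis irr_rho : mx_irreducible rho.

Lemma mxcent_unit : {in mxcent rho, forall A, A != 0 -> A \in unitmx}.
Proof.
move=> A /mxcentP cA nzA; apply: mx_Schur irr_rho _ _ nzA.
by apply/centgmxP=> g _; apply: cA.
Qed.

Lemma card_rV_mxcent k b :
  mxcent_basis k b -> (#|{: 'rV[F]_n.+1}| <= #|mxcent rho| ^ k)%N.
Proof.
case=> span_b _.
pose f (e : {ffun 'I_k -> 'M[F]_n.+1}) := \sum_(i < k) b i *m e i.
rewrite -[k in (_ ^ k)%N]card_ord -card_ffun_on.
apply: leq_trans (leq_image_card f _); apply/subset_leq_card/subsetP=> v _.
have [e ce ->] := span_b v; apply/imageP; exists [ffun i : 'I_k => e i].
  by apply/ffun_onP=> i; rewrite ffunE.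
by apply: eq_bigr => i _; rewrite ffunE.
Qed.

(* A linear relation between the cocycles over the centralizer would make one
   of the zero sets redundant in the intersection; the independent cocycles
   are determined by their values at the generators. *)
Lemma card_irredundant_zero_sets m (A : {set gT}) (I : finType) (T : {set I})
    (D : I -> gT -> 'rV[F]_n.+1) :
  mxcent_dim_le m -> <<A>>%g = [set: gT] -> {in T, forall i, cocycle (D i)} ->
  {in T, forall i, exists2 g, D i g != 0 & {in T :\ i, forall j, D j g = 0}} ->
  (#|T| <= m * #|A|)%N.
Proof.
move=> [k [b [lekm basis_b]]] genA cD irrT.
have gt1E : (1 < #|mxcent rho|)%N.
  apply/card_gt1P; exists 0, 1; split; rewrite ?rpred0 ?rpred1 //.
  by rewrite eq_sym oner_eq0.
(* Both sides become exponents of [#|E|]. It then suffices to inject the families of coefficients in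
   [E] supported on [T] into [V ^ A], which has at most [#|E| ^ (m * #|A|)] elements. *)
rewrite -(leq_exp2l _ _ gt1E) expnM -(card_pffun_on 0).
apply: leq_trans (_ : #|{: 'rV[F]_n.+1}| ^ #|A| <= _)%N; last first.
  have [->|A_gt0] := posnP #|A|; first by [].
  rewrite leq_exp2r // (leq_trans (card_rV_mxcent basis_b)) //.
  by rewrite leq_exp2l.
rewrite -[#|A| in leqRHS]card_ord -card_ffun.
pose f (e : {ffun I -> 'M[F]_n.+1}) :=
  [ffun l : 'I_#|A| => \sum_(i in T) D i (enum_val l) *m e i].
apply: (@leq_card_in _ _ f) => e1 e2 /pffun_onP[/supportP e1T e1E].
case/pffun_onP=> /supportP e2T e2E eq_f.
pose e i := e1 i - e2 i.
have cent_e i : i \in T -> e i \in mxcent rho.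
  by move=> Ti; apply: rpredB; [apply: e1E | apply: e2E]; apply: image_f.
pose S g := \sum_(i in T) D i g *m e i.
have cS : cocycle S.
  move=> g h; rewrite mulmx_suml -big_split; apply: eq_bigr => i Ti /=.
  rewrite cD // mulmxDl -!mulmxA; congr (_ *m _ + _).
  by have /mxcentP/(_ h) := cent_e i Ti.
have S0 : S =1 fun=> 0.
  apply: cocycle_gen_eq0 cS genA _ => x Ax; apply/eqP.
  rewrite /S -(enum_rankK_in Ax Ax).
  rewrite (eq_bigr _ (fun i _ => mulmxBr _ _ _)) sumrB subr_eq0.
  by have /ffunP/(_ (enum_rank_in Ax x)) := eq_f; rewrite !ffunE => ->.
apply/ffunP=> i; have [Ti|nTi] := boolP (i \in T); last by rewrite e1T ?e2T.
apply/eqP; rewrite -subr_eq0; apply/negPn/negP=> nz_ei.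
have [g nzDg Dg] := irrT i Ti; case/eqP: nzDg.
have := S0 g; rewrite /S (bigD1 i) //= big1 ?addr0 => [|j /andP[Tj ji]].
  rewrite -{2}[D i g](mulmxK (mxcent_unit (cent_e i Ti) nz_ei)) => ->.
  by rewrite mul0mx.
by rewrite Dg ?mul0mx // !inE ji.
Qed.
End Cocycles.

(** * Encoding the zero sets of derivations by polynomial coordinates *)

Lemma gen_ind (gT : finGroupType) (A : {set gT}) (P : gT -> Prop) :
  P 1%g -> (forall x y, x \in A -> P y -> P (x * y)%g) ->
  {in <<A>>%g, forall g, P g}.
Proof.
move=> P1 PM g /gen_prodgP[m [c Ac ->]].
elim: m c Ac => [|m IH] c Ac; first by rewrite big_ord0.
by rewrite big_ord_recl; apply: PM; [apply: Ac | apply: IH => i; apply: Ac].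
Qed.

(** Choosing one code for each element gives an injection. A relation is used because a subgroup has
    many codes, one for each choice of representation, derivation, basis and generator. *)
Lemma card_le_rel (T C : finType) (S : {set T}) (R : T -> C -> Prop) :
  {in S, forall x, exists c, R x c} ->
  (forall x y c, R x c -> R y c -> x = y) -> (#|S| <= #|C|)%N.
Proof.
move=> exR injR; have [->|[x0 Sx0]] := set_0Vmem S; first by rewrite cards0.
have [c0 _] := exR x0 Sx0.
pose f x := odflt c0 [pick c | `[< R x c >]].
have Rf x : x \in S -> R x (f x).
  rewrite /f; case: pickP => [c /asboolP //|nR /exR[c Rxc]].
  by have /asboolP := nR c.
apply: (@leq_card_in _ _ f) => x y Sx Sy eq_f.
by apply: injR (Rf x Sx) _; rewrite eq_f; apply: Rf.
Qed.

Section Transport.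
Variables (gT : finGroupType) (F : finFieldType) (n : nat) (A : {set gT}).
Implicit Types (rho : mx_representation F [set: gT]%G n.+1) (k : nat).
Implicit Types (b : nat -> 'rV[F]_n.+1) (a : 'M[F]_n.+1) (P : nat -> {poly F}).

(** If [b] is a basis and [a] generates the centralizer, every vector has this form, and its
    coordinates [P i] are unique modulo the minimal polynomial of [a]. *)
Definition poly_comb k b a P := \sum_(i < k) b i *m horner_mx a (P i).

Lemma mul_repr1 rho (v : 'rV[F]_n.+1) : v *m rho 1%g = v.
Proof. by rewrite repr_mx1 mulmx1. Qed.

Lemma mul_reprM rho (v : 'rV[F]_n.+1) x y :
  v *m rho (x * y)%g = v *m rho x *m rho y.
Proof. by rewrite repr_mxM ?inE // mulmxA. Qed.

Lemma mxcent_horner rho a p : a \in mxcent rho -> horner_mx a p \in mxcent rho.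
Proof.
by move=> /mxcentP ca; apply/mxcentP=> g; apply: comm_horner_mx; apply: ca.
Qed.

Lemma poly_comb_eq0 rho k b a P :
  mxcent_basis rho k b -> a \in mxcent rho -> poly_comb k b a P = 0 ->
  forall i, (i < k)%N -> mxminpoly a %| P i.
Proof.
move=> [_ indep] ca P0 i ltik; apply: mxminpoly_min.
by apply: (indep (fun i => horner_mx a (P i))) => // j; apply: mxcent_horner.
Qed.

Lemma poly_comb_dvd0 k b a P :
  (forall i, (i < k)%N -> mxminpoly a %| P i) -> poly_comb k b a P = 0.
Proof.
move=> dvP; apply: big1 => i _; have /dvdpP[q ->] := dvP i (ltn_ord i).
by rewrite rmorphM /= mx_root_minpoly mulr0 mulmx0.
Qed.

Lemma poly_combD k b a P Q :
  poly_comb k b a (fun i => P i + Q i) = poly_comb k b a P + poly_comb k b a Q.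
Proof. by rewrite -big_split; apply: eq_bigr => i _; rewrite rmorphD mulmxDr. Qed.

(** Polynomials in [a] commute with [rho g], so the images of the basis determine the action. The
    new coordinates are computed from [X] and [P] alone, so two representations with the same [X]
    transform coordinates alike. *)
Lemma poly_comb_act rho k b a P (X : nat -> nat -> {poly F}) g :
  a \in mxcent rho ->
  (forall i, (i < k)%N -> b i *m rho g = poly_comb k b a (X i)) ->
  poly_comb k b a P *m rho g =
    poly_comb k b a (fun j => \sum_(i < k) X i j * P i).
Proof.
move=> ca Xg; rewrite mulmx_suml.
under [RHS]eq_bigr do rewrite raddf_sum mulmx_sumr.
rewrite exchange_big; apply: eq_bigr => i _ /=.
have cPg : horner_mx a (P i) *m rho g = rho g *m horner_mx a (P i).
  by have /mxcentP/(_ g) := mxcent_horner (P i) ca.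
rewrite -mulmxA cPg mulmxA Xg // mulmx_suml.
by apply: eq_bigr => j _; rewrite -mulmxA rmorphM.
Qed.

(* The partial map [poly_comb k b1 a1 P |-> poly_comb k b2 a2 P] is an
   isomorphism of modules carrying D1 to D2. *)
Lemma cocycle_transport rho1 rho2 k b1 b2 a1 a2
    (D1 D2 : gT -> 'rV[F]_n.+1) :
  <<A>>%g = [set: gT] ->
  mxcent_basis rho1 k b1 -> a1 \in mxcent rho1 ->
  a2 \in mxcent rho2 -> mxminpoly a1 = mxminpoly a2 ->
  cocycle rho1 D1 -> cocycle rho2 D2 ->
  {in A, forall x i, (i < k)%N -> exists X,
     b1 i *m rho1 x = poly_comb k b1 a1 X /\
     b2 i *m rho2 x = poly_comb k b2 a2 X} ->
  {in A, forall x, exists Y,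
     D1 x = poly_comb k b1 a1 Y /\ D2 x = poly_comb k b2 a2 Y} ->
  forall g, D1 g = 0 -> D2 g = 0.
Proof.
move=> genA basis1 c1 c2 eq_min cD1 cD2 actA valA g.
(* The statement is strengthened for an induction over words in the generators: equal coordinates
   stay equal under the action of [g], and [D1 g], [D2 g] share coordinates. The common minimal
   polynomial then carries vanishing from one side to the other. *)
suff [_ [P [-> ->]]] :
    (forall P, exists Q, poly_comb k b1 a1 P *m rho1 g = poly_comb k b1 a1 Q /\
                         poly_comb k b2 a2 P *m rho2 g = poly_comb k b2 a2 Q) /\
    exists P, D1 g = poly_comb k b1 a1 P /\ D2 g = poly_comb k b2 a2 P.
  move=> P0; apply: poly_comb_dvd0; rewrite -eq_min.
  exact: poly_comb_eq0 basis1 c1 P0.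
move: g (in_setT g); rewrite -genA; apply: gen_ind => [|x y Ax [IHP [Q [D1y D2y]]]].
  split=> [P|]; first by exists P; split; apply: mul_repr1.
  exists (fun=> 0); rewrite (cocycle1 cD1) (cocycle1 cD2).
  by split; symmetry; apply: big1 => i _; rewrite rmorph0 mulmx0.
split=> [P|].
  have /choice[X X12] i : exists X, (i < k)%N ->
      b1 i *m rho1 x = poly_comb k b1 a1 X /\
      b2 i *m rho2 x = poly_comb k b2 a2 X.
    have [ltik|] := boolP (i < k)%N; last by exists (fun=> 0).
    by have [X] := actA x Ax i ltik; exists X.
  have [R [R1 R2]] := IHP (fun j => \sum_(i < k) X i j * P i).
  exists R; split; rewrite mul_reprM.
    by rewrite (poly_comb_act P c1 (fun i ltik => (X12 i ltik).1)); exact: R1.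
  by rewrite (poly_comb_act P c2 (fun i ltik => (X12 i ltik).2)); exact: R2.
have [Y [Y1 Y2]] := valA x Ax; have [R [R1 R2]] := IHP Y; exists (fun i => R i + Q i).
by split; rewrite poly_combD -?R1 -?R2 -?D1y -?D2y -?Y1 -?Y2; [apply: cD1 | apply: cD2].
Qed.
End Transport.

Section Codes.
Variables (gT : finGroupType) (F : finFieldType) (n : nat) (A : {set gT}).
Variable (m : nat).

Definition cocycle_zero_set (M : {set gT}) : Prop :=
  exists (rho : mx_representation F [set: gT]%G n.+1) (D : gT -> 'rV[F]_n.+1),
    [/\ mx_irreducible rho, mxcent_dim_le rho m, cocycle rho D
      & forall g, (g \in M) = (D g == 0)].

Local Notation vcode := {ffun 'I_m -> 'rV[F]_n.+1}.
Local Notation code :=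
  ('I_m.+1 * 'rV[F]_n.+2 * {ffun 'I_m * 'I_#|A| -> vcode}
    * {ffun 'I_#|A| -> vcode})%type.

(** A row holds a polynomial of degree at most [n], enough for remainders modulo the minimal
    polynomial of [a], whose degree is at most [n.+1]. That polynomial itself takes one more
    coefficient, hence the [n.+2] in [code]. Indices from [m] on decode to 0. *)
Definition decode (u : vcode) (i : nat) : {poly F} :=
  if insub i is Some j then rVpoly (u j) else 0.

(* c = (k, minimal polynomial of a, coordinates of the action, coordinates of D),
   where the coordinates are polynomials in a along the basis b. *)
Definition encodes (M : {set gT}) (c : code) : Prop :=
  exists (rho : mx_representation F [set: gT]%G n.+1) (D : gT -> 'rV[F]_n.+1)
    (b : nat -> 'rV[F]_n.+1) (a : 'M[F]_n.+1),
  [/\ cocycle rho D, (forall g, (g \in M) = (D g == 0)) /\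
      mxcent_basis rho c.1.1.1 b, a \in mxcent rho,
      mxminpoly a = rVpoly c.1.1.2
    & forall l : 'I_#|A|, D (enum_val l) = poly_comb c.1.1.1 b a (decode (c.2 l))
      /\ forall i : 'I_m, (i < c.1.1.1)%N -> b i *m rho (enum_val l) =
           poly_comb c.1.1.1 b a (decode (c.1.2 (i, l)))].

Lemma encodes_exists M : cocycle_zero_set M -> exists c, encodes M c.
Proof.
case=> rho [D [irr_rho [k [b [lekm basis_b]]] cD defM]].
have [a ca prim_a] := mxcent_primitive (mxcent_unit irr_rho).
have exu v : exists u : vcode, v = poly_comb k b a (decode u).
  have [e ce ->] := basis_b.1 v.
  exists [ffun i : 'I_m => poly_rV (mx_inv_horner a (e i))].
  apply: eq_bigr => i _; congr (_ *m _).
  rewrite /decode insubT ?(leq_trans (ltn_ord i)) //= => ltim.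
  rewrite ffunE poly_rV_K; last first.
    apply: leq_trans (size_poly _ _) _; rewrite -ltnS -size_mxminpoly.
    rewrite -(size_char_poly a) dvdp_leq ?mxminpoly_dvd_char //.
    by rewrite monic_neq0 // char_poly_monic.
  have [P defe] := prim_a _ (ce i).
  by rewrite mx_inv_hornerK // defe horner_mx_mem.
have [u uP] := choice exu.
exists (inord k, poly_rV (mxminpoly a),
  [ffun il : 'I_m * 'I_#|A| => u (b il.1 *m rho (enum_val il.2))],
  [ffun l : 'I_#|A| => u (D (enum_val l))]).
exists rho, D, b, a; rewrite /= inordK //; split=> //.
  rewrite poly_rV_K // -(size_char_poly a) dvdp_leq ?mxminpoly_dvd_char //.
  by rewrite monic_neq0 // char_poly_monic.
by move=> l; rewrite ffunE -uP; split=> // i _; rewrite ffunE -uP.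
Qed.

Lemma encodes_sub (M1 M2 : {set gT}) c :
  <<A>>%g = [set: gT] -> encodes M1 c -> encodes M2 c -> M1 \subset M2.
Proof.
move=> genA [rho1 [D1 [b1 [a1 [cD1 [M1E basis1] c1 min1 val1]]]]].
move=> [rho2 [D2 [b2 [a2 [cD2 [M2E basis2] c2 min2 val2]]]]].
apply/subsetP=> g; rewrite M1E M2E => /eqP D1g; apply/eqP.
apply: (cocycle_transport (b2 := b2) genA basis1 c1 c2 _ cD1 cD2 _ _ D1g)
  => [|x Ax i ltik|x Ax].
- by rewrite min1.
- have ltim : (i < m)%N by rewrite (leq_trans ltik) // -ltnS.
  have [_ /(_ (Ordinal ltim) ltik)] := val1 (enum_rank_in Ax x).
  have [_ /(_ (Ordinal ltim) ltik)] := val2 (enum_rank_in Ax x).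
  rewrite enum_rankK_in // => E2 E1; eexists; split; [exact: E1 | exact: E2].
have [E1 _] := val1 (enum_rank_in Ax x); have [E2 _] := val2 (enum_rank_in Ax x).
rewrite enum_rankK_in // in E1 E2.
by eexists; split; [exact: E1 | exact: E2].
Qed.

(** The exponent counts codes. With [q = #|F| ^ n.+1], one has [m.+1 <= q ^ m] for the dimension and
    [#|F| ^ n.+2 <= q ^ 2] for the minimal polynomial; each [vcode] has [q ^ m] values, and there
    are [m * #|A|] of them for the action and [#|A|] for the derivation. *)
Lemma card_cocycle_zero_sets (S : {set {group gT}}) :
    <<A>>%g = [set: gT] ->
    {in S, forall M : {group gT}, cocycle_zero_set M} ->
  (#|S| <= (#|F| ^ n.+1) ^ (m + 2 + m * (m * #|A|) + m * #|A|))%N.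
Proof.
move=> genA zeroS.
have leSC : (#|S| <= #|{: code}|)%N.
  apply: (@card_le_rel _ _ _ (fun M : {group gT} => encodes M)).
    by move=> M /zeroS/encodes_exists.
  move=> M1 M2 c M1c M2c; apply/val_inj/eqP.
  by rewrite eqEsubset (encodes_sub genA M1c M2c) (encodes_sub genA M2c M1c).
apply: leq_trans leSC _.
have gt1F := finNzRing_gt1 F.
rewrite !card_prod !card_ffun card_prod !card_ord !card_mx !mul1n.
rewrite !expnD !leq_mul //.
- rewrite (leq_trans (ltn_expl m (isT : (1 < 2)%N))) // -!expnM.
  rewrite (@leq_trans (2 ^ (n.+1 * m))) ?leq_pexp2l ?leq_pmull //.
  by case: (n.+1 * m)%N => // e; rewrite leq_exp2r.
- by rewrite -[leqLHS]expn1 leq_pexp2l // ltnW.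
- by rewrite -?expnM -?mulnA.
- by rewrite -?expnM -?mulnA.
Qed.
End Codes.

(** * Maximal subgroups of finite solvable groups *)

Section Chief.
Variables (gT : finGroupType).
Local Notation G := [set: gT]%G.
Implicit Types (U W M : {group gT}).
Hypothesis solG : solvable G.

Lemma chief_normal U W :
  chief_factor G W U -> [/\ W <| G, U <| G & W \proper U]%g.
Proof.
case/andP=> /maxgroupp/andP[prWU nWG] nUG; split=> //.
by rewrite /normal subsetT.
Qed.

Lemma chief_minnormal U W :
  chief_factor G W U -> minnormal (U / W)%g (G / W)%g.
Proof.
move=> chiefUW; have [nWG nUG _] := chief_normal chiefUW.
case/andP: chiefUW => maxW _.
apply: maxnormal_minnormal maxW; last exact: normal_norm.
exact: subset_trans (subsetT U) (normal_norm nWG).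
Qed.

Lemma chief_abelem U W :
  chief_factor G W U -> is_abelem (U / W)%g /\ (U / W != 1)%g.
Proof.
move=> chiefUW; have sUG : (U / W \subset G / W)%g by rewrite quotientS ?subsetT.
by have [] := minnormal_solvable (chief_minnormal chiefUW) sUG (quotient_sol W solG).
Qed.

(** By maximality of [M], the subgroup [M * U] is everything. The intersection [M :&: U] is
    normalized by [M], and by [U] because [U / W] is abelian; being normal and properly below [U],
    it equals [W]. *)
Lemma chief_maximal U W M :
    chief_factor G W U -> maximal M G -> W \subset M -> ~~ (U \subset M) ->
  (M * U = [set: gT])%g /\ M :&: U = W.
Proof.
move=> chiefUW maxM sWM nsUM.
have [nWG nUG prWU] := chief_normal chiefUW.
have nU x : x \in 'N(U)%g by have /subsetP-> := normal_norm nUG; rewrite ?inE.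
have MU : (M * U = [set: gT])%g.
  have nUM : M \subset 'N(U)%g by apply/subsetP.
  have [_ maxM2] := maxgroupP maxM.
  rewrite -norm_joinEl //; apply/eqP; apply: contraNT nsUM => nMU.
  rewrite -(maxM2 (M <*> U)%G) ?joing_subr ?joing_subl //.
  by rewrite properEneq nMU subsetT.
split=> //; have /andP[/maxgroupP[_ maxW] _] := chiefUW.
apply: (maxW (M :&: U)%G); last by rewrite subsetI sWM proper_sub.
rewrite properEneq subsetIr andbT; apply/andP; split.
  by apply: contra nsUM => /eqP <-; apply: subsetIl.
rewrite /= -MU mulG_subG normsI ?normG //=; last by apply/subsetP.
have sWMU : W \subset M :&: U by rewrite subsetI sWM proper_sub.
apply: normal_norm; apply: sub_der1_normal (subsetIr _ _).
apply: subset_trans sWMU; rewrite der1_min //.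
  by rewrite (subset_trans (subsetT _)) ?normal_norm.
by have [/is_abelemP[p _ /abelem_abelian]] := chief_abelem chiefUW.
Qed.

Lemma index_chief_maximal U W M :
    chief_factor G W U -> maximal M G -> W \subset M -> ~~ (U \subset M) ->
  #|G : M|%g = #|U : W|%g.
Proof.
move=> chiefUW maxM sWM nsUM.
have [MU MIU] := chief_maximal chiefUW maxM sWM nsUM.
by rewrite /= -MU -MIU indexMg setIC indexgI.
Qed.

(** An isomorphism of modules from [U / W] to the row space, written as a map on the elements of [U]
    rather than on cosets. *)
Definition chief_coords U W p n (rho : mx_representation 'F_p G n.+1)
    (phi : gT -> 'rV['F_p]_n.+1) : Prop :=
  [/\ {in U &, forall u v, phi (u * v)%g = phi u + phi v},
      forall v, exists2 u, u \in U & phi u = v,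
      {in U, forall u, (phi u == 0) = (u \in W)}
    & {in U, forall u g, phi (u ^ g)%g = phi u *m rho g}].

Lemma chief_coords_exist U W : chief_factor G W U ->
  exists p n (rho : mx_representation 'F_p G n.+1) phi,
    [/\ prime p, chief_coords U W rho phi, mx_irreducible rho
      & (p ^ n.+1)%N = #|U : W|%g].
Proof.
move=> chiefUW; have [nWG nUG prWU] := chief_normal chiefUW.
have [/is_abelemP[p p_pr abelE] ntE] := chief_abelem chiefUW.
have sWU := proper_sub prWU.
have nW x : x \in 'N(W)%g by have /subsetP-> := normal_norm nWG; rewrite ?inE.
have nWU : (W <| U)%g by apply: normalS sWU (subsetT _) nWG.
have nE : (G / W \subset 'N(U / W))%g by apply: quotient_norms (normal_norm nUG).
pose rQ := abelem_repr abelE ntE nE.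
have irrQ : mx_irreducible rQ by apply/abelem_mx_irrP/chief_minnormal.
have eqG : (coset_morphism W @*^-1 (G / W)%G)%g == G.
  by rewrite [(_ @*^-1 _)%g](quotientGK nWG).
pose rho := eqg_repr (morphpre_repr (coset_morphism W) rQ) eqG.
exists p, (abelem_dim' (U / W)%G), rho, (fun u => abelem_rV abelE ntE (coset W u)).
split=> //.
- split.
  + by move=> u v Uu Uv; rewrite morphM // abelem_rV_M ?mem_quotient.
  + move=> v; have /morphimP[u _ Uu defv] := mem_rVabelem abelE ntE v.
    by exists u; rewrite // -(rVabelemK abelE ntE v) defv.
  + move=> u Uu; rewrite -(abelem_rV_1 abelE ntE).
    rewrite (inj_in_eq (@abelem_rV_inj _ _ _ abelE ntE)) ?group1 ?mem_quotient //.
    by apply/eqP/idP => [/coset_idr->|/coset_id].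
  + move=> u Uu g; rewrite morphJ // (abelem_rV_J abelE ntE nE) ?mem_quotient //.
- apply/eqg_mx_irr/morphpre_mx_irr => //.
  by rewrite [X in X \subset _]/= morphimS ?normal_norm.
rewrite -card_quotient ?normal_norm // -(card_abelem_rV abelE ntE) card_mx mul1n.
by rewrite card_Fp.
Qed.

(** In [g = m u] with [m] in [M] and [u] in [U], the component [u] is determined modulo
    [M :&: U = W]. Its image under [phi] is the derivation, and it vanishes exactly when [u], hence
    [g], lies in [M]. *)
Lemma chief_cocycle U W M p n (rho : mx_representation 'F_p G n.+1) phi :
    chief_factor G W U -> maximal M G -> W \subset M -> ~~ (U \subset M) ->
    chief_coords U W rho phi ->
  exists2 D, cocycle rho D & forall g, (g \in M) = (D g == 0).
Proof.
move=> chiefUW maxM sWM nsUM [phiM _ phi0 phiJ].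
have [MU MIU] := chief_maximal chiefUW maxM sWM nsUM.
have phiE m1 u1 m2 u2 : m1 \in M -> m2 \in M -> u1 \in U -> u2 \in U ->
  (m1 * u1 = m2 * u2)%g -> phi u1 = phi u2.
  move=> Mm1 Mm2 Uu1 Uu2 eq_mu.
  have Uu12 : (u1 * u2^-1)%g \in U by rewrite groupM ?groupV.
  have defu12 : (u1 * u2^-1 = m1^-1 * m2)%g.
    by apply: (mulgI m1); rewrite mulgA eq_mu mulKVg mulgK.
  have /eqP phi12 : phi (u1 * u2^-1)%g == 0.
    by rewrite phi0 // -MIU inE Uu12 andbT defu12 groupM ?groupV.
  by rewrite -[u1](mulgKV u2) phiM // phi12 add0r.
have /choice[f fP] g : exists mu, [/\ mu.1 \in M, mu.2 \in U & g = (mu.1 * mu.2)%g].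
  have /mulsgP[m u Mm Uu ->] : g \in (M * U)%g by rewrite MU inE.
  by exists (m, u).
have [nWG nUG _] := chief_normal chiefUW.
have nU x y : x \in U -> (x ^ y)%g \in U.
  by move=> Ux; rewrite memJ_norm //; have /subsetP-> := normal_norm nUG; rewrite ?inE.
exists (fun g => phi (f g).2) => [g h|g].
  have [Mg Ug defg] := fP g; have [Mh Uh defh] := fP h.
  have [Mgh Ugh defgh] := fP (g * h)%g.
  (* For [g = m u] and [h = m' u'] one has [g h = m m' (u' u^h)], so [u' u^h] is a [U]-component of
     [g h]; hence the exchange of the two summands. *)
  rewrite -phiJ // addrC -phiM ?nU //.
  apply: (phiE (f (g * h)%g).1 _ ((f g).1 * (f h).1)%g) => //.
  - exact: groupM.
  - by rewrite groupM // nU.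
  by rewrite -defgh -mulgA (mulgA (f h).1) -defh -conjgC mulgA -defg.
have [Mg Ug defg] := fP g.
by rewrite phi0 // -MIU inE Ug andbT {1}defg groupMl.
Qed.
End Chief.

(** * Number and indices of maximal subgroups *)

Section MaximalSubgroups.
Variables (gT : finGroupType) (A : {set gT}) (m : nat).
Local Notation G := [set: gT]%G.
Implicit Types (U W M H : {group gT}) (S T : {set {group gT}}).

Definition irredundant S : Prop :=
  {in S, forall M, ~~ (\bigcap_(N in S :\ M) N \subset M)}.

(** The hypothesis of the theorem, read in a finite quotient: [K / W] is a complement of [U / W],
    and every matrix form of the module [U / W] is subject to the bound. *)
Definition complemented_dim_le : Prop :=
  forall U W p n (rho : mx_representation 'F_p G n.+1) phi,
    prime p -> chief_factor G W U ->
    (exists K : {group gT}, (K * U = [set: gT])%g /\ K :&: U = W) ->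
    chief_coords U W rho phi -> mxcent_dim_le rho m.

Lemma irredundantS S T : S \subset T -> irredundant T -> irredundant S.
Proof.
move=> /subsetP sST irrT M SM; apply: contra (irrT M (sST M SM)).
apply: subset_trans; apply/bigcapsP=> N /setD1P[NM SN].
by apply: bigcap_inf; rewrite !inE NM sST.
Qed.

Hypothesis solG : solvable G.
Hypothesis genA : <<A>>%g = [set: gT].
Hypothesis dimG : complemented_dim_le.

Lemma maximal_nsub_chief M s W :
    maximal M G -> (G.-chief).-series%g W s -> last W s = G -> W \subset M ->
  exists U' W', [/\ chief_factor G W' U', W' \subset M & ~~ (U' \subset M)].
Proof.
move=> maxM; elim: s W => [|U s IH] W /= => [_ -> sGM|/andP[chUW chs] lastG sWM].
  by have /maxgroupp := maxM; rewrite /proper sGM andbF.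
by have [sUM|nsUM] := boolP (U \subset M); [apply: (IH U) | exists U, W].
Qed.

(** All members of [S] complement the same factor, so one representation carries all their
    derivations. Irredundancy gives, for each [M] in [S], an element at which only the derivation of
    [M] is nonzero. *)
Lemma card_irredundant_chief S U W :
    chief_factor G W U -> irredundant S ->
    {in S, forall M, [/\ maximal M G, W \subset M & ~~ (U \subset M)]} ->
  (#|S| <= m * #|A|)%N.
Proof.
move=> chUW irrS maxS; have [->|[M0 SM0]] := set_0Vmem S; first by rewrite cards0.
have [p [n [rho [phi [p_pr phiP irr_rho _]]]]] := chief_coords_exist solG chUW.
have [maxM0 sWM0 nsUM0] := maxS M0 SM0.
have dim_rho : mxcent_dim_le rho m.
  apply: (dimG p_pr chUW _ phiP); exists M0.
  exact: chief_maximal chUW maxM0 sWM0 nsUM0.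
have /choice[D DP] M : exists D, M \in S ->
    cocycle rho D /\ forall g, (g \in M) = (D g == 0).
  have [SM|_] := boolP (M \in S); last by exists (fun=> 0).
  have [maxM sWM nsUM] := maxS M SM.
  by have [D cD zD] := chief_cocycle solG chUW maxM sWM nsUM phiP; exists D.
apply: (card_irredundant_zero_sets irr_rho (D := D) dim_rho genA) => M SM.
  by have [] := DP M SM.
have /subsetPn[g /bigcapP gN gM] := irrS M SM; exists g.
  by have [_ <-] := DP M SM.
move=> N SN; apply/eqP; have [|_ <-] := DP N; last exact: gN.
by case/setD1P: SN.
Qed.

(** Induction along the series. The members of [S] containing [U] are left to the rest of the
    series; each of the others has index [#|U : W|], and there are at most [m * #|A|] of them. The
    factor [#|H U : H W|] of the index of [H W] pays for these. *)
Lemma prod_index_series s W S H :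
    (G.-chief).-series%g W s -> last W s = G -> irredundant S -> (W <| G)%g ->
    {in S, forall M, [/\ maximal M G, W \subset M & H \subset M]} ->
  (\prod_(M in S) #|G : M|%g <= #|G : (H <*> W)%G|%g ^ (m * #|A|))%N.
Proof.
elim: s W S => [|U s IH] W S /= => [_ defW irrS nWG maxS|].
  rewrite big1 ?expn_gt0 ?indexg_gt0 // => M /maxS[/maxgroupp].
  by rewrite /proper defW => /andP[_ /negP].
case/andP=> chUW chs lastG irrS nWG maxS.
have [_ nUG prWU] := chief_normal chUW.
have nU (K : {group gT}) : (K \subset 'N(U))%g.
  by rewrite (subset_trans (subsetT K)) ?normal_norm.
have nW (K : {group gT}) : (K \subset 'N(W))%g.
  by rewrite (subset_trans (subsetT K)) ?normal_norm.
have sWU := proper_sub prWU.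
have sHWU : (H <*> W)%G \subset (H <*> U)%G by rewrite genS ?setUS.
rewrite -(Lagrange_index (subsetT (H <*> U)%G) sHWU) expnMn.
rewrite (bigID (fun M : {group gT} => U \subset M)) /= leq_mul //.
  under eq_bigl do rewrite -(in_set (fun M => (M \in S) && (U \subset M))).
  apply: IH => //.
    by apply: irredundantS irrS; apply/subsetP=> M; rewrite inE => /andP[].
  by move=> M; rewrite inE => /andP[/maxS[]].
have [eqS0|] := set_0Vmem [set M in S | ~~ (U \subset M)].
  rewrite big_pred0 ?expn_gt0 ?indexg_gt0 // => M.
  by have /setP/(_ M) := eqS0; rewrite !inE.
case=> M0; rewrite inE => /andP[SM0 nsUM0].
have [maxM0 sWM0 sHM0] := maxS M0 SM0.
have [MU MIU] := chief_maximal solG chUW maxM0 sWM0 nsUM0.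
(* Since [H W] lies in [M0], it meets [U] inside [M0 :&: U = W]. *)
have -> : #|(H <*> U)%G : (H <*> W)%G|%g = #|U : W|%g.
  have -> : (H <*> U)%G = ((H <*> W)%G * U)%g :> {set gT}.
    by rewrite -norm_joinEl //= -joingA (joing_idPr sWU).
  rewrite indexMg -indexgI; congr #|_ : _|%g; apply/eqP; rewrite eqEsubset.
  rewrite subsetI sWU joing_subr !andbT.
  apply: subset_trans (_ : M0 :&: U \subset W); last by rewrite MIU.
  by rewrite setIC setSI // join_subG sHM0.
rewrite (eq_bigr (fun=> #|U : W|%g)) => [|M /andP[/maxS[maxM sWM _] nsUM]]; last first.
  exact: index_chief_maximal.
rewrite prod_nat_const leq_pexp2l ?indexg_gt0 //.
rewrite -cardsE.
apply: card_irredundant_chief chUW _ _.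
  by apply: irredundantS irrS; apply/subsetP=> M; rewrite inE => /andP[].
by move=> M; rewrite inE => /andP[/maxS[]].
Qed.

Lemma prod_index_irredundant S H :
    irredundant S -> {in S, forall M, maximal M G /\ H \subset M} ->
  (\prod_(M in S) #|G : M|%g <= #|G : H|%g ^ (m * #|A|))%N.
Proof.
move=> irrS maxS; have [s chs lastG] := chief_series_exists (normal_refl G).
have := prod_index_series (H := H) chs lastG irrS (normal1 _).
rewrite /= joingG1 => -> // M /maxS[]; split=> //; exact: sub1G.
Qed.

(** A maximal subgroup of index [n] is a zero set in dimension [k.+1] over ['F_p] with
    [p ^ k.+1 = n]. As [n] determines [p] and [k], all of them are counted by the same codes. *)
Lemma card_maximal_index n : (1 < n)%N ->
  (#|[set M : {group gT} | maximal M G & #|G : M|%g == n]|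
    <= n ^ (m + 2 + m * (m * #|A|) + m * #|A|))%N.
Proof.
move=> n_gt1.
have coords M : maximal M G -> #|G : M|%g = n -> exists p k,
    [/\ prime p, (p ^ k.+1)%N = n & @cocycle_zero_set _ 'F_p k m M].
  move=> maxM indM; have [s chs lastG] := chief_series_exists (normal_refl G).
  have [U [W [chUW sWM nsUM]]] := maximal_nsub_chief maxM chs lastG (sub1G _).
  have [p [k [rho [phi [p_pr phiP irr_rho cardUW]]]]] := chief_coords_exist solG chUW.
  exists p, k; split=> //.
    by rewrite cardUW -(index_chief_maximal solG chUW maxM).
  have [D cD zD] := chief_cocycle solG chUW maxM sWM nsUM phiP.
  exists rho, D; split=> //; apply: (dimG p_pr chUW _ phiP); exists M.
  exact: chief_maximal.
have [->|[M0]] := set_0Vmem [set M : {group gT} | maximal M G & #|G : M|%g == n].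
  by rewrite cards0.
rewrite inE => /andP[maxM0 /eqP/(coords M0 maxM0)[p [k [p_pr def_n _]]]].
have := @card_cocycle_zero_sets _ 'F_p k A m _ genA.
rewrite card_Fp // def_n; apply=> M; rewrite inE => /andP[maxM /eqP indM].
have [q [l [q_pr def_n' zM]]] := coords M maxM indM.
have eq_qp : q = p by rewrite -(pdiv_pfactor l q_pr) def_n' -def_n pdiv_pfactor.
subst q; have [eq_lk] : l.+1 = k.+1.
  by rewrite -(pfactorK l.+1 p_pr) def_n' -def_n pfactorK.
by subst l.
Qed.
End MaximalSubgroups.

(** * Counting *)

(** Telescoping, from [1 / (b + 1)^3 <= 1 / (2 b) - 1 / (2 (b + 1))]. *)
Lemma sum_inv_cube_le (B : nat) :
  \sum_(n < B.+2 | (1 < n)%N) (n%:R ^- 3 : rat) <= 2^-1 - (2 * B.+1%:R)^-1.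
Proof.
elim: B => [|B IH].
  by rewrite big_pred0 => [|n]; rewrite ?mulr1 ?subrr // ltnNge -ltnS ltn_ord.
rewrite big_mkcond big_ord_recr /= -big_mkcond /=.
apply: le_trans (lerD IH (lexx _)) _.
have b0 : 0 < B.+1%:R :> rat by rewrite ltr0n.
rewrite -[B.+2]addn1 natrD; move: (B.+1%:R : rat) b0 => b b0.
rewrite -subr_ge0.
have -> : 2^-1 - (2 * (b + 1%:R))^-1 - (2^-1 - (2 * b)^-1 + (b + 1%:R) ^- 3) =
   (b ^+ 2 + 1) / (2 * b * (b + 1) ^+ 3).
  by field; apply/andP; split; lra.
by rewrite divr_ge0 ?mulr_ge0 ?exprn_ge0 ?addr_ge0 ?sqr_ge0 ?ler01 // ltW.
Qed.

(** With [s] the sum over the tail, adding a term [x] leaves an excess [x (1 - 2 s)] on the right,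
    nonnegative because [s <= 1/2]. *)
Lemma prod1D_le (I : Type) (r : seq I) (Q : pred I) (x : I -> rat) :
  (forall i, Q i -> 0 <= x i) -> \sum_(i <- r | Q i) x i <= 2^-1 ->
  \prod_(i <- r | Q i) (1 + x i) <= 1 + 2 * \sum_(i <- r | Q i) x i.
Proof.
move=> x_ge0; elim: r => [|i r IH]; first by rewrite !big_nil mulr0 addr0.
rewrite !big_cons; case: ifP => // /x_ge0 xi_ge0 sum_le.
have s_ge0 : 0 <= \sum_(j <- r | Q j) x j by apply: sumr_ge0.
have {}IH := IH (le_trans _ sum_le).
have -> : 1 + 2 * (x i + \sum_(j <- r | Q j) x j) =
  (1 + x i) * (1 + 2 * \sum_(j <- r | Q j) x j)
    + x i * (1 - 2 * \sum_(j <- r | Q j) x j) by ring.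
rewrite -[leLHS]addr0 lerD //.
  by apply: ler_wpM2l; [lra | apply: IH; lra].
by apply: mulr_ge0 => //; lra.
Qed.

(* Rankin's trick: a subset of weight at most N is counted with the factor
   (N / weight)^(c+3) >= 1, and these factors sum to an Euler product. *)
Lemma card_prod_le (I : finType) (Q : {set I}) (w : I -> nat) (c N : nat) :
  {in Q, forall i, (1 < w i)%N} ->
  (forall n, (1 < n)%N -> (#|[set i in Q | w i == n]| <= n ^ c)%N) ->
  (#|[set S : {set I} | (S \subset Q) && (\prod_(i in S) w i <= N)]|
     <= 2 * N ^ (c + 3))%N.
Proof.
move=> w_gt1 card_w; set s := (c + 3)%N.
pose x i : rat := (w i)%:R ^- s.
have x_ge0 i : 0 <= x i by rewrite invr_ge0 exprn_ge0 ?ler0n.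
have sum_x : \sum_(i in Q) x i <= 2^-1.
  pose B := \max_i w i.
  apply: le_trans (_ : \sum_(n < B.+2 | (1 < n)%N) (n%:R ^- 3 : rat) <= _); last first.
    by apply: le_trans (sum_inv_cube_le B) _; rewrite gerBl invr_ge0 mulr_ge0 ?ler0n.
  (* Grouping by weight: at most [n ^ c] elements of weight [n] contribute [n ^- (c + 3)] each,
     together at most [n ^- 3]. *)
  rewrite (partition_big (fun i => inord (w i) : 'I_B.+2) (fun n => 1 < n)%N) /=;
    last first.
    by move=> i Qi; rewrite inordK ?w_gt1 // ltnS leqW // leq_bigmax.
  apply: ler_sum => n n_gt1.
  rewrite (eq_big (fun i => i \in [set i in Q | w i == n]) (fun=> n%:R ^- s));
    first last.
  - move=> i; rewrite /x => /andP[_ /eqP <-]; rewrite inordK //.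
    by rewrite ltnS leqW // leq_bigmax.
  - by move=> i; rewrite inE -val_eqE /= inordK // ltnS leqW // leq_bigmax.
  have n0 : 0 < n%:R :> rat by rewrite ltr0n ltnW.
  rewrite sumr_const -[leLHS]mulr_natr.
  rewrite mulrC ler_pdivrMr ?exprn_gt0 // exprD mulrCA mulVf ?mulr1; last first.
    by rewrite expf_neq0 // gt_eqF.
  by rewrite -natrX ler_nat card_w.
have prod_x : \prod_(i in Q) (1 + x i) <= 2.
  by apply: le_trans (prod1D_le _ sum_x) _ => //; lra.
rewrite -(ler_nat rat) natrM natrX -sum1_card natr_sum.
(* The product of the [1 + x i] is expanded over all subsets; the value 0 outside [Q] removes those
   not contained in [Q]. Each counted [S] has a term at least 1, because its weight is at most
   [N]. *)
apply: le_trans (_ : \sum_(S : {set I}) N%:R ^+ s *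
   \prod_i (if i \in S then (if i \in Q then x i else 0) else 1) <= _); last first.
  rewrite -mulr_sumr mulrC ler_wpM2r ?exprn_ge0 ?ler0n //.
  rewrite -(bigA_distr 1 +%R) /=; apply: le_trans prod_x.
  rewrite [leRHS]big_mkcond le_eqVlt; apply/orP; left; apply/eqP.
  by apply: eq_bigr => i _; case: ifP; rewrite ?addr0 addrC // add0r.
rewrite big_mkcond; apply: ler_sum => S _; rewrite inE; case: ifP; last first.
  move=> _; rewrite mulr_ge0 ?exprn_ge0 ?ler0n //.
  by apply: prodr_ge0 => i _; case: ifP => // _; case: ifP.
case/andP=> /subsetP sSQ leN.
rewrite -big_mkcond /= (eq_bigr x) => [|i /sSQ ->] //.
rewrite prodfV prodrXl -natr_prod.
rewrite ler_pdivlMr ?mul1r; last first.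
  rewrite exprn_gt0 // ltr0n prodn_cond_gt0 // => i /sSQ/w_gt1; exact: ltnW.
by rewrite lerXn2r ?nnegrE ?ler0n // ler_nat.
Qed.

(** * Intersections of maximal subgroups in a finite solvable group *)

Section FiniteBound.
Variable (gT : finGroupType).
Local Notation G := [set: gT]%G.

Definition meet_of_maximals (H : {group gT}) : bool :=
  [exists S : {set {group gT}},
     [forall M in S, maximal (gval M) G] && (\bigcap_(M in S) M == H :> {set gT})].

(** A family with intersection [H] that is minimal under inclusion is irredundant. *)
Lemma meet_of_maximals_irredundant H : meet_of_maximals H ->
  exists S : {set {group gT}},
    [/\ irredundant S, {in S, forall M, maximal (gval M) G}
      & \bigcap_(M in S) M = H :> {set gT}].
Proof.
case/existsP=> S0 PS0.
pose P (S : {set {group gT}}) :=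
  [forall M in S, maximal (gval M) G] && (\bigcap_(M in S) M == H :> {set gT}).
have [S minS _] := @minset_exists _ P S0 PS0.
have /andP[/forall_inP maxS /eqP defH] := minsetp minS.
exists S; split=> // M SM; apply/negP=> sSM.
have /setP/(_ M) : S :\ M = S.
  apply: (minsetinf minS) (subsetDl _ _); apply/andP; split.
    by apply/forall_inP=> N /setD1P[_ /maxS].
  rewrite -defH [X in _ == X](big_setD1 M SM) /=; apply/eqP; symmetry.
  exact/setIidPr.
by rewrite !inE eqxx SM.
Qed.

(** [m + 2 + m * c + c] is the exponent for maximal subgroups and 3 is the loss in Rankin's trick.
    The factor [c] comes from the weight bound [n ^ c], and the summand 1 absorbs the constant 2, as
    [2 <= n]. *)
Definition meet_exponent (m d : nat) : nat :=
  let c := (m * d)%N in (1 + c * (m + 2 + m * c + c + 3))%N.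

Lemma card_meet_of_maximals (A : {set gT}) (m d n : nat) :
    solvable G -> <<A>>%g = [set: gT] -> complemented_dim_le gT m ->
    (#|A| <= d)%N -> (0 < n)%N ->
  (#|[set H : {group gT} | meet_of_maximals H & #|G : H|%g == n]|
     <= n ^ meet_exponent m d)%N.
Proof.
move=> solG genA dimG leAd n_gt0.
(* Index 1 is treated apart, since the constant 2 is not at most [n] there; only the whole group has
   this index. *)
have [n_le1|n_gt1] := leqP n 1.
  have -> : n = 1%N by apply/eqP; rewrite eqn_leq n_le1.
  rewrite exp1n -[leqRHS](cards1 G); apply/subset_leq_card/subsetP=> H; rewrite !inE.
  rewrite indexg_eq1 => /andP[_ sGH]; apply/eqP/val_inj/eqP.
  by rewrite /= eqEsubset subsetT.
set c := (m * #|A|)%N; set c1 := (m + 2 + m * c + c)%N.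
pose Q := [set M : {group gT} | maximal M G].
have w_gt1 : {in Q, forall M : {group gT}, (1 < #|G : M|%g)%N}.
  move=> M; rewrite inE => /maxgroupp prM.
  by rewrite indexg_gt1 proper_subn.
have card_w k : (1 < k)%N ->
    (#|[set M in Q | #|G : (M : {group gT})|%g == k]| <= k ^ c1)%N.
  move=> k_gt1; have := card_maximal_index solG genA dimG k_gt1.
  by congr (_ <= _)%N; apply: eq_card => M; rewrite !inE.
have := card_prod_le (n ^ c) w_gt1 card_w.
set T := [set S : {set {group gT}} | _] => card_T.
apply: (@leq_trans #|T|).
  apply: leq_trans (leq_imset_card (fun S : {set {group gT}} =>
    [group of \bigcap_(M in S) M]) T).
  apply/subset_leq_card/subsetP=> H; rewrite inE => /andP[meetH /eqP indH].
  have [S [irrS maxS defH]] := meet_of_maximals_irredundant meetH.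
  apply/imsetP; exists S; last exact/val_inj.
  rewrite inE; apply/andP; split; first by apply/subsetP=> M /maxS; rewrite inE.
  rewrite -indH; apply: prod_index_irredundant => // M SM; split; first exact: maxS.
  by rewrite -defH; apply: bigcap_inf.
apply: leq_trans card_T _; rewrite -expnM /meet_exponent expnD expn1 leq_mul //.
by rewrite leq_pexp2l // /c1 /c !leq_mul ?leq_add ?leq_mul //.
Qed.
End FiniteBound.

Local Close Scope ring_scope.
From mathcomp Require Import classical_sets functions cardinality topology.

Local Open Scope classical_set_scope.
Local Open Scope card_scope.
Local Open Scope group_scope.

(** * Finite quotients of a topological group *)

(** It suffices to bound finite subfamilies. This permits the passage to a finite quotient, because
    finitely many open subgroups of finite index contain a common open normal subgroup. *)
Lemma card_le_ord (T : pointedType) (A : set T) (N : nat) :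
    (forall k (h : 'I_k -> T), injective h -> (forall i, A (h i)) -> (k <= N)%N) ->
  A #<= `I_N.
Proof.
move=> bound; apply/negPn/negP=> nleA.
have : `I_N.+1 #<= A.
  have [[n An]|/infiniteP infA] := pselect (finite_set A); last first.
    exact: card_le_trans (subset_card_le (@subsetT _ _)) infA.
  move: An; rewrite card_eq_le => /andP[leAn leIn].
  apply: card_le_trans leIn; rewrite card_le_II ltnNge.
  by apply: contra nleA; rewrite -card_le_II; apply: card_le_trans.
case/pcard_leP=> f.
have := bound N.+1 (fun i => f i); rewrite ltnn => H.
suff : false by []. apply: H => [i j eq_f|i].
  by apply/val_inj; apply: (inj (f := f)) eq_f; rewrite inE /=.
by apply: funS => /=.
Qed.

Section Cosets.
Variable G : groupType.
Implicit Types (H N : set G) (x y : G).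

Lemma is_subgroupP H : is_subgroup H <->
  [/\ H 1, forall x y, H x -> H y -> H (x * y) & forall x, H x -> H x^-1].
Proof.
split=> [gH|[H1 HM HV]].
  split; first by have [/set_mem] := gH.
    by move=> x y /mem_set Hx /mem_set Hy; apply/set_mem/(group_closedM gH).
  by move=> x /mem_set Hx; apply/set_mem/(group_closedV gH).
split=> [|x y /set_mem Hx /set_mem Hy]; apply/mem_set => //.
by apply: HM => //; apply: HV.
Qed.

Lemma setmul_set1 N x y : setmul N [set x] y <-> N (y * x^-1).
Proof.
split=> [[n Nn [_ -> <-]]|Nyx]; first by rewrite mulgK.
by exists (y * x^-1) => //; exists x => //; rewrite mulgVK.
Qed.

Lemma coset_eq N x y :
  is_subgroup N -> setmul N [set x] = setmul N [set y] <-> N (x * y^-1).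
Proof.
move=> /is_subgroupP[N1 NM NV]; split=> [eqN|Nxy].
  by apply/setmul_set1; rewrite -eqN; apply/setmul_set1; rewrite mulgV.
apply/seteqP; split=> z /setmul_set1 Nz; apply/setmul_set1.
  by rewrite -[z](mulgVK x) -mulgA; apply: NM.
rewrite -[z](mulgVK y) -mulgA; apply: NM => //.
by rewrite -[y * _]invgK invgM invgK; apply: NV.
Qed.

Lemma setmul_coset N x y : is_normal N ->
  setmul (setmul N [set x]) (setmul N [set y]) = setmul N [set x * y].
Proof.
move=> [/is_subgroupP[N1 NM NV] NJ]; apply/seteqP; split=> z.
  case=> a /setmul_set1 Na [b /setmul_set1 Nb <-]; apply/setmul_set1.
  have -> : a * b * (x * y)^-1 = a * x^-1 * (b * y^-1) ^ x^-1.
    by rewrite conjgE invgK invgM !mulgA mulgVK.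
  by apply: NM => //; apply: NJ.
move=> /setmul_set1 Nz; exists (z * y^-1).
  by apply/setmul_set1; rewrite -mulgA -invgM.
by exists y; rewrite ?mulgVK //; apply/setmul_set1; rewrite mulgV.
Qed.

Lemma setconj_coset N x g : is_normal N ->
  setconj (setmul N [set x]) g = setmul N [set x ^ g].
Proof.
move=> [/is_subgroupP[N1 NM NV] NJ]; apply/seteqP; split=> z.
  case=> a /setmul_set1 Na <-; apply/setmul_set1.
  by rewrite -conjVg -conjMg; apply: NJ.
move=> /setmul_set1 Nz; exists (z ^ g^-1); last by rewrite conjgKV.
by apply/setmul_set1; rewrite -[x](conjgK g) -conjVg -conjMg; apply: NJ.
Qed.

Lemma solvable_quotient_morph N : is_normal N -> solvable_quotient N ->
  exists (gT : finGroupType) (pi : G -> gT),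
    [/\ forall x y, pi (x * y) = pi x * pi y, forall z : gT, exists x, pi x = z,
        forall x, N x <-> pi x = 1 & solvable [set: gT]%SET].
Proof.
move=> nN [gT [phi [[_ phi_inj phi_surj] phiM solT]]].
have cos x : cosets [set: G] N (setmul N [set x]) by exists x.
exists gT, (fun x => phi (setmul N [set x])).
have piM x y : phi (setmul N [set x * y]) =
    phi (setmul N [set x]) * phi (setmul N [set y]).
  by rewrite -phiM // setmul_coset.
have pi1 : phi (setmul N [set 1]) = 1.
  by apply: (@mulIg _ (phi (setmul N [set 1]))); rewrite -piM !mul1g.
split=> // [y|x]; first by have [_ [x _ <-] <-] := phi_surj y I; exists x.
rewrite -[X in N X]mulg1 -[X in N (_ * X)]invg1 -(coset_eq _ _ nN.1) -pi1.
by split=> [->//|]; apply: phi_inj; rewrite inE.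
Qed.
End Cosets.

(** * Correspondence of subgroups under a surjection onto a finite group *)

Section FiniteImage.
Variables (G : groupType) (gT : finGroupType) (pi : G -> gT).
Hypothesis piM : forall x y, pi (x * y) = pi x * pi y.
Hypothesis pi_surj : forall z, exists x, pi x = z.
Implicit Types (K L M : {group gT}) (H : set G) (x y g : G).

Lemma pi1 : pi 1 = 1.
Proof. by apply: (@mulIg _ (pi 1)); rewrite -piM !mul1g. Qed.

Lemma piV x : pi x^-1 = (pi x)^-1.
Proof. by apply: (@mulIg _ (pi x)); rewrite -piM !mulVg pi1. Qed.

Lemma piJ x y : pi (x ^ y) = pi x ^ pi y.
Proof. by rewrite conjgE !piM piV -conjgE. Qed.

Definition pre (K : {set gT}) : set G := [set x | pi x \in K].

Definition img H : {set gT} := [set z | `[< exists2 x, H x & pi x = z >]]%SET.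

Lemma mem_imgP H z : reflect (exists2 x, H x & pi x = z) (z \in img H).
Proof. by rewrite inE; apply: asboolP. Qed.

Lemma preS (K L : {set gT}) : (pre K `<=` pre L) <-> K \subset L.
Proof.
split=> [sKL|/fintype.subsetP sKL x]; last exact: sKL.
by apply/fintype.subsetP=> z; have [x <-] := pi_surj z; apply: sKL.
Qed.

Lemma pre_inj : injective pre.
Proof.
move=> K L eqKL; apply/eqP; rewrite finset.eqEsubset; apply/andP.
by split; apply/preS; rewrite eqKL.
Qed.

Lemma pre_group K : is_subgroup (pre K).
Proof.
apply/is_subgroupP.
by split=> [|x y|x]; rewrite /pre /= ?pi1 ?piM ?piV ?groupV //; apply: groupM.
Qed.

Lemma pre_normal K : K <| [set: gT]%SET -> is_normal (pre K).
Proof.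
move=> nK; split=> [|x g]; first exact: pre_group.
rewrite /pre /= piJ memJ_norm //; by have /fintype.subsetP-> := normal_norm nK.
Qed.

Lemma pre_ker K x : pi x = 1 -> pre K x.
Proof. by rewrite /pre /= => ->. Qed.

Lemma img_group_set H : is_subgroup H -> group_set (img H).
Proof.
move=> /is_subgroupP[H1 HM _]; apply/group_setP.
split=> [|_ _ /mem_imgP[x Hx <-] /mem_imgP[y Hy <-]].
  by apply/mem_imgP; exists 1; rewrite ?pi1.
by apply/mem_imgP; exists (x * y); [apply: HM | rewrite piM].
Qed.

Definition img_group H (gH : is_subgroup H) : {group gT} := Group (img_group_set gH).

Lemma img_normal H : is_normal H -> [set: gT]%SET \subset 'N(img H).
Proof.
move=> [_ nH]; apply/fintype.subsetP=> z _; rewrite finset.inE.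
apply/fintype.subsetP=> _ /imsetP[w /mem_imgP[x Hx <-] ->].
have [g <-] := pi_surj z; apply/mem_imgP; exists (x ^ g); [exact: nH | exact: piJ].
Qed.

Lemma imgK H : is_subgroup H -> (forall x, pi x = 1 -> H x) -> pre (img H) = H.
Proof.
move=> /is_subgroupP[H1 HM HV] kerH; apply/seteqP; split=> x; last first.
  by move=> Hx; apply/mem_imgP; exists x.
case/mem_imgP=> y Hy eq_pi; rewrite -[x](mulgVK y); apply: HM => //; apply: kerH.
by rewrite piM piV eq_pi mulgV.
Qed.

Lemma coset_pre K x : setmul (pre K) [set x] = pre (K :* pi x).
Proof.
apply/seteqP; split=> y.
  by move/setmul_set1; rewrite /pre /= piM piV mem_rcoset.
by rewrite /pre /= mem_rcoset -piV -piM => Ky; apply/setmul_set1.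
Qed.

Lemma index_pre K n : has_index (pre K) n -> #|[set: gT]%SET : K| = n.
Proof.
move=> indK; apply/card_eq_II; apply: card_eq_trans indK; rewrite card_eq_sym.
have -> : cosets [set: G] (pre K) =
    [set pre C | C in [set` rcosets K [set: gT]%SET]].
  apply/seteqP; split=> A.
    case=> x _ <-; exists (K :* pi x); last by rewrite coset_pre.
    by apply/rcosetsP; exists (pi x); rewrite ?finset.inE.
  case=> C /rcosetsP[z _ ->] <-; have [x <-] := pi_surj z.
  by exists x; rewrite ?coset_pre.
apply: card_eq_trans (inj_card_eq (in2W pre_inj)) _.
suff -> : [set` rcosets K [set: gT]%SET] =
    [set enum_val x | x in [set: 'I_#|[set: gT]%SET : K|]].
  apply: card_eq_trans (inj_card_eq (in2W enum_val_inj)) _.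
  by rewrite card_eq_sym card_II.
apply/seteqP; split=> C /=; last by case=> l _ <-; apply: enum_valP.
by move=> KC; exists (enum_rank_in KC C); rewrite ?enum_rankK_in.
Qed.
End FiniteImage.

(** * Open subgroups and homomorphisms with open kernel *)

Section TopologicalGroupFacts.
Variable G : topologicalGroupType.
Implicit Types (H N : set G) (x g : G).

Lemma mulgr_continuous g : continuous (fun x : G => x * g).
Proof.
move=> x; apply: (@continuous_comp _ _ _ (fun y => (y, g))
  (fun p : G * G => p.1 * p.2)).
  by apply: cvg_pair; [apply: cvg_id | apply: cvg_cst].
exact: mulg_continuous.
Qed.

Lemma mulgl_continuous g : continuous (fun x : G => g * x).
Proof.
move=> x; apply: (@continuous_comp _ _ _ (fun y => (g, y))
  (fun p : G * G => p.1 * p.2)).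
  by apply: cvg_pair; [apply: cvg_cst | apply: cvg_id].
exact: mulg_continuous.
Qed.

Lemma conjg_continuous g : continuous (fun x : G => x ^ g).
Proof.
move=> x; apply: (@continuous_comp _ _ _ (fun y => y * g) (fun y => g^-1 * y)).
  exact: mulgr_continuous.
exact: mulgl_continuous.
Qed.

Lemma open_finite_bigcap (F : set (set G)) :
  finite_set F -> (forall A, F A -> open A) -> open (\bigcap_(A in F) A).
Proof.
move=> finF openF; rewrite -closedC setC_bigcap.
by apply: closed_bigcup => // A FA; rewrite closedC; apply: openF.
Qed.

Lemma setconj_open H g : open H -> open (setconj H g).
Proof.
move=> openH; have -> : setconj H g = (fun x => x ^ g^-1) @^-1` H.
  apply/seteqP; split=> x /=; first by case=> y Hy <-; rewrite conjgK.
  by move=> Hx; exists (x ^ g^-1) => //; rewrite conjgKV.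
by apply: open_comp openH => x _; apply: conjg_continuous.
Qed.

(** The normal core is the intersection of the conjugates of [H]. There are finitely many of them,
    as the conjugate by [g] depends only on the coset [H g]. *)
Lemma open_core H n : open_subgroup H -> has_index H n ->
  exists2 N, open_normal N & N `<=` H.
Proof.
move=> [openH /is_subgroupP[H1 HM HV]] indH.
pose F := [set setconj H g | g in [set: G]].
have finF : finite_set F.
  have finC : finite_set (cosets [set: G] H) by exists n.
  (* This function recovers the conjugate of [H] by [g] from the coset [H g]. *)
  apply: sub_finite_set (finite_image
    (fun A => [set z | forall a, A a -> H (z ^ a^-1)]) finC).
  move=> _ [g _ <-]; exists (setmul H [set g]); first by exists g.
  apply/seteqP; split=> z.
    move=> Hz; exists (z ^ g^-1); last by rewrite conjgKV.
    by apply: Hz; apply/setmul_set1; rewrite mulgV.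
  case=> y Hy <- a /setmul_set1 Ha.
  have -> : (y ^ g) ^ a^-1 = (a * g^-1) * y * (a * g^-1)^-1.
    by rewrite !conjgE invgK invgM invgK !mulgA.
  by apply: (HM) (HM _ _ Ha Hy) (HV _ Ha).
exists (\bigcap_(A in F) A); last first.
  move=> x /(_ (setconj H 1)); case; first by exists 1.
  by move=> y Hy <-; rewrite conjg1.
split; first by apply: open_finite_bigcap => // _ [g _ <-]; apply: setconj_open.
have memF x : (\bigcap_(A in F) A) x <-> forall g, H (x ^ g).
  split=> [Nx g|Hx _ [g _ <-]].
    by have [y Hy <-] := Nx (setconj H g^-1) (ex_intro2 _ _ _ I erefl); rewrite conjgKV.
  by exists (x ^ g^-1); rewrite ?conjgKV.
split=> [|x g /memF Nx]; last by apply/memF=> h; rewrite -conjgM.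
apply/is_subgroupP; split=> [|x y /memF Nx /memF Ny|x /memF Nx]; apply/memF=> g.
- by rewrite conj1g.
- by rewrite conjMg; apply: HM.
- by rewrite conjVg; apply: HV.
Qed.

Lemma open_normal_bigcap (I : finType) (N : I -> set G) :
  (forall i, open_normal (N i)) -> open_normal (\bigcap_(i in [set: I]) N i).
Proof.
move=> oN; split.
  have -> : \bigcap_(i in [set: I]) N i = \bigcap_(A in range N) A.
    by rewrite bigcap_image.
  apply: open_finite_bigcap; first by apply: finite_image; apply: finite_finset.
  by move=> _ [i _ <-]; case: (oN i).
split=> [|x g Nx i _]; last by have [_ [_]] := oN i; apply; apply: Nx.
apply/is_subgroupP; split=> [i _|x y Nx Ny i _|x Nx i _];
  have [_ [/is_subgroupP[N1 NM NV] _]] := oN i.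
- by [].
- by apply: NM; [apply: Nx | apply: Ny].
- by apply: NV; apply: Nx.
Qed.

Section OpenKernel.
Variables (gT : finGroupType) (pi : G -> gT).
Hypothesis piM : forall x y, pi (x * y) = pi x * pi y.
Hypothesis pi_surj : forall z, exists x, pi x = z.
Hypothesis open_ker : open [set x | pi x = 1].
Implicit Types K M : {group gT}.

Lemma open_pre (K : {set gT}) : open (pre pi K).
Proof.
rewrite openE => x Kx; rewrite /interior nbhsE.
exists ((fun y => y * x^-1) @^-1` [set x | pi x = 1]); first split.
- by apply: open_comp open_ker => y _; apply: mulgr_continuous.
- by rewrite /= mulgV pi1.
move=> y /=; rewrite piM (piV piM) => /(canRL (mulgKV _)).
by rewrite mul1g /pre /= => ->.
Qed.

(** The preimage of [<<img pi S>>] is a subgroup containing [S], and it is closed because its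
    complement is also a preimage, hence open. So it contains the closure of the subgroup generated
    by [S]. *)
Lemma gen_img (S : set G) :
  closure (smallest (@is_subgroup G) S) = [set: G] -> <<img pi S>> = [set: gT]%SET.
Proof.
move=> clS; apply/eqP; rewrite finset.eqEsubset finset.subsetT /=.
apply/(preS pi_surj) => x _; have : [set: G] x by [].
rewrite -clS closureE; apply; split.
  rewrite -openC (_ : ~` _ = pre pi (~: <<img pi S>>)); first exact: open_pre.
  by apply/seteqP; split=> y; rewrite /pre /= finset.inE => /negP.
apply: smallest_sub; first exact: pre_group.
by move=> y Sy; apply/mem_gen/mem_imgP; exists y.
Qed.

(** Each member of [F] contains [H], hence the kernel, and is therefore the preimage of its image;
    the correspondence preserves maximality, intersections and index. *)
Lemma img_meet_of_maximals n (H : set G) (gH : is_subgroup H) :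
    (forall x, pi x = 1 -> H x) -> max_intersections G n H ->
  meet_of_maximals (img_group piM gH) && (#|[set: gT]%SET : img_group piM gH| == n).
Proof.
move=> kerH [_ indH [F [maxF defH]]]; apply/andP; split; last first.
  by apply/eqP/(index_pre piM pi_surj); rewrite /= imgK.
apply/existsP; exists [set M : {group gT} | `[< F (pre pi M) >]]%SET.
apply/andP; split.
  apply/forall_inP=> M; rewrite finset.inE => /asboolP/maxF[_ nMT maxM].
  apply/maxgroupP; split.
    rewrite properT; apply/negP=> /eqP eqMT; apply: nMT.
    by apply/seteqP; split=> [//|x _]; rewrite /pre /= eqMT finset.inE.
  move=> L prL sML; have [|/(pre_inj pi_surj) //|eqLT] := maxM _ (pre_group piM L).
    exact/preS.
  case/negP: (proper_subn prL); apply/(preS pi_surj) => x _.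
  by rewrite eqLT.
apply/eqP/(pre_inj pi_surj); rewrite /= imgK // defH.
apply/seteqP; split=> x.
  move=> /finset.bigcapP Sx M FM.
  have [[_ gM] _ _] := maxF M FM.
  have kerM y : pi y = 1 -> M y by move=> /kerH; rewrite defH; apply.
  have defM := imgK piM gM kerM; rewrite -defM; apply: (Sx (img_group piM gM)).
  by rewrite finset.inE; apply/asboolP; rewrite /= defM.
move=> Fx; apply/finset.bigcapP=> M; rewrite finset.inE => /asboolP FM.
exact: Fx FM.
Qed.
End OpenKernel.
End TopologicalGroupFacts.

(** * From representations of the finite quotient to modules over the topological group *)

Section AdditiveMatrix.
 Local Open Scope ring_scope.
Variables (p n : nat).

Definition additive_mx (f : {additive 'rV['F_p]_n -> 'rV['F_p]_n}) : 'M['F_p]_n :=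
  \matrix_i f (delta_mx 0 i).

(** Every scalar of ['F_p] is a natural multiple of 1, so an additive map is linear. *)
Lemma mul_additive_mx f v : v *m additive_mx f = f v.
Proof.
rewrite mulmx_sum_row [in RHS](row_sum_delta v) raddf_sum; apply: eq_bigr => i _.
rewrite rowK -[v 0 i in RHS]natr_Zp scaler_nat raddfMn -scaler_nat.
by congr (_ *: _); rewrite natr_Zp.
Qed.

End AdditiveMatrix.

Section Dimension.
Variables (G : topologicalGroupType) (gT : finGroupType) (pi : G -> gT).
Hypothesis piM : forall x y, pi (x * y) = pi x * pi y.
Hypothesis pi_surj : forall z, exists x, pi x = z.
Hypothesis open_ker : open [set x | pi x = 1].
Implicit Types U W : {group gT}.

Section PullBack.
Variables (p n : nat) (rho : mx_representation 'F_p [set: gT]%G n.+1).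

Definition pullback_gmodule : gmodule G.
Proof.
refine (@GModule G 'rV['F_p]_n.+1 (fun v g => v *m rho (pi g))%R _ _ _).
- by move=> u v g; rewrite mulmxDl.
- by move=> v; rewrite pi1 // repr_mx1 mulmx1.
- by move=> v g h; rewrite piM repr_mxM ?finset.inE // mulmxA.
Defined.

(** Endomorphisms of the module and matrices commuting with [rho] correspond, through [additive_mx]
    in one direction, where surjectivity of [pi] enters, and through right multiplication in the
    other. *)
Lemma endG_dim_mxcent k :
  endG_dim pullback_gmodule k -> exists b, mxcent_basis rho k b.
Proof.
case=> b [span_b indep_b].
exists (fun i => if insub i is Some j then b j else 0%R); split=> [v|e ce e0 i ltik].
  have [e [ende ->]] := span_b v.
  exists (fun i => if insub i is Some j then additive_mx (e j) else 0%R).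
    move=> i; case: insubP => [j _ _|_]; last exact: rpred0.
    apply/mxcentP=> z; have [g <-] := pi_surj z.
    apply/row_matrixP=> l; rewrite !rowE !mulmxA !mul_additive_mx.
    exact/esym/(ende j).
  apply: eq_bigr => i _; rewrite !valK.
  by rewrite mul_additive_mx.
pose f (i : 'I_k) : {additive 'rV['F_p]_n.+1 -> 'rV['F_p]_n.+1} := mulmxr (e i).
have endf j : endG (V := pullback_gmodule) (f j).
  move=> v g /=; rewrite -!mulmxA; congr (_ *m _)%R.
  by have /mxcentP/(_ (pi g)) := ce j.
apply/row_matrixP=> l; rewrite rowE row0.
apply: (indep_b f endf _ (Ordinal ltik)).
by rewrite -[RHS]e0; apply: eq_bigr => j _; rewrite valK.
Qed.

Variables (U W : {group gT}) (phi : gT -> 'rV['F_p]_n.+1).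
Hypothesis p_pr : prime p.
Hypothesis chUW : chief_factor [set: gT]%SET W U.
Hypothesis phiP : chief_coords U W rho phi.

(** The preimage in [U] of a submodule under [phi] is a normal subgroup between [W] and [U], hence
    one of the two. *)
Lemma pullback_irreducible : gmod_irreducible pullback_gmodule.
Proof.
have [phiM phi_surj phi0 phiJ] := phiP.
have [nWG nUG prWU] := chief_normal chUW.
split.
  exists (const_mx 1%R : 'rV['F_p]_n.+1) => /matrixP/(_ 0%R 0%R)/eqP.
  by rewrite !mxE oner_eq0.
move=> X [X0 XB] Xact.
have XN v : v \in X -> (- v)%R \in X by move=> Xv; rewrite -sub0r; apply: XB.
have XD u v : u \in X -> v \in X -> (u + v)%R \in X.
  by move=> Xu Xv; rewrite -[v]opprK; apply: XB => //; apply: XN.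
pose L := [set u in U | phi u \in X]%SET.
have phi1 : phi 1 = 0%R by apply/eqP; rewrite phi0.
have gL : group_set L.
  apply/group_setP; split=> [|x y]; rewrite !finset.inE ?group1 ?phi1 //.
  by move=> /andP[Ux Xx] /andP[Uy Xy]; rewrite groupM //= phiM //; apply: XD.
have nL : [set: gT]%SET \subset 'N(Group gL).
  apply/fintype.subsetP=> z _; rewrite finset.inE.
  apply/fintype.subsetP=> _ /imsetP[u + ->].
  rewrite !finset.inE => /andP[Uu Xu]; have [g <-] := pi_surj z.
  rewrite memJ_norm ?Uu /=; last by have /fintype.subsetP-> := normal_norm nUG.
  by rewrite phiJ //; apply/mem_set/Xact/set_mem.
have sWL : W \subset Group gL.
  apply/fintype.subsetP=> w Ww; have Uw := fintype.subsetP (proper_sub prWU) w Ww.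
  by rewrite !finset.inE Uw; have /eqP-> : phi w == 0%R by rewrite phi0.
have sLU : Group gL \subset U.
  by apply/fintype.subsetP=> u; rewrite !finset.inE => /andP[].
have [eqLU|neqLU] := eqVneq L U.
  right; apply/seteqP; split=> // v _; have [u Uu <-] := phi_surj v.
  by move: Uu; rewrite -eqLU !finset.inE => /andP[_ /set_mem].
left; have /andP[/maxgroupP[_ maxW] _] := chUW.
have eqLW : L = W.
  by apply: (maxW (Group gL)) => //; rewrite nL finset.properEneq neqLU sLU.
apply/seteqP; split=> [v Xv|v ->]; last exact: set_mem.
have [u Uu defv] := phi_surj v; apply/eqP; rewrite -defv phi0 // -eqLW.
by rewrite !finset.inE Uu defv; apply/mem_set.
Qed.

Lemma pre_open_normal (K : {group gT}) :
  K <| [set: gT]%SET -> open_normal (pre pi K).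
Proof. by move=> nK; split; [apply: open_pre | apply: pre_normal]. Qed.

Lemma pre_chief : open_chief_factor (pre pi U) (pre pi W).
Proof.
have [nWG nUG prWU] := chief_normal chUW; have sWU := proper_sub prWU.
split; [exact: pre_open_normal nUG | exact: pre_open_normal nWG | |].
  split; first exact/(preS pi_surj).
  by move=> /(preS pi_surj); apply/negP; rewrite fintype.proper_subn.
move=> N nN sWN sNU.
have kerN x : pi x = 1 -> N x by move=> pix; apply: sWN; apply: pre_ker.
have defN : pre pi (img_group piM nN.1) = N by apply: (imgK piM nN.1 kerN).
rewrite -defN; have [eqNU|neqNU] := eqVneq (img pi N) U.
  by right; rewrite /= eqNU.
left; congr pre; have /andP[/maxgroupP[_ maxW] _] := chUW.
apply: maxW; last by apply/(preS pi_surj); rewrite defN.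
rewrite finset.properEneq neqNU (img_normal piM pi_surj) // andbT /=.
by apply/(preS pi_surj); rewrite [pre _ _]defN.
Qed.

Lemma pre_complemented (K : {group gT}) :
  K * U = [set: gT]%SET -> K :&: U = W -> complemented (pre pi U) (pre pi W).
Proof.
move=> KU KIU; have [nWG nUG prWU] := chief_normal chUW.
have nW := pre_normal piM nWG.
have [W1 WM WV] := (is_subgroupP _).1 (pre_group piM W).
have sWK : W \subset K by rewrite -KIU subsetIl.
exists (pre pi K); split; [exact: pre_group | exact/(preS pi_surj) | |].
  apply/seteqP; split=> [A [[k Kk <-] [u Uu]]|A ->].
    move=> /(coset_eq _ _ nW.1) Wuk /=.
    have Wk : pre pi W k.
      have := Uu.
      move: Wuk; rewrite /pre /= piM (piV piM) -KIU finset.inE => /andP[Kuk Uuk] Uu'.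
      rewrite finset.inE [_ \in K]Kk /=.
      by move: Uuk; rewrite groupMl // groupV.
    have := (coset_eq k 1 nW.1).2; rewrite invg1 mulg1 => /(_ Wk) ->.
    by apply/seteqP; split=> z; [move/setmul_set1|move=> Wz; apply/setmul_set1];
      rewrite invg1 mulg1.
  have eqW1 : setmul (pre pi W) [set 1] = pre pi W.
    by apply/seteqP; split=> z; [move/setmul_set1|move=> Wz; apply/setmul_set1];
      rewrite invg1 mulg1.
  by split; exists 1 => //; rewrite /pre /= (pi1 piM); apply: group1.
apply/seteqP; split=> A.
  case=> _ [k _ <-] [_ [u _ <-] <-]; exists (k * u) => //.
  by rewrite (setmul_coset _ _ nW).
case=> g _ <-; have : pi g \in K * U by rewrite KU finset.inE.
case/mulsgP=> k u Kk Uu defg; have [x defx] := pi_surj k.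
exists (setmul (pre pi W) [set x]); first by exists x => //; rewrite /pre /= defx.
exists (setmul (pre pi W) [set x^-1 * g]); last by rewrite (setmul_coset _ _ nW) mulKVg.
by exists (x^-1 * g) => //; rewrite /pre /= piM (piV piM) defx defg mulKg.
Qed.

Lemma pre_isom : gmod_isom_section pullback_gmodule (pre pi U) (pre pi W).
Proof.
have [phiM phi_surj phi0 phiJ] := phiP.
have [nWG nUG prWU] := chief_normal chUW; have sWU := proper_sub prWU.
have nW := pre_normal piM nWG; have gW := nW.1; have nU := pre_normal piM nUG.
have [W1 WM WV] := (is_subgroupP _).1 gW.
(* [xget] selects an element of the coset [A]; the value is independent of this choice because [phi]
   vanishes on [W]. *)
pose f (A : set G) : 'rV['F_p]_n.+1 := phi (pi (xget 1 A)).
have fE x : pre pi U x -> f (setmul (pre pi W) [set x]) = phi (pi x).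
  move=> Ux; rewrite /f; set y := xget _ _.
  have /setmul_set1 : setmul (pre pi W) [set x] y.
    by apply: xgetPex; exists x; apply/setmul_set1; rewrite mulgV.
  move=> Wyx; have Uyx := fintype.subsetP sWU _ Wyx.
  rewrite -[y](mulgVK x) piM phiM //.
  by have /eqP-> : phi (pi (y * x^-1)) == 0%R; rewrite ?phi0 ?add0r.
exists f; split.
- split=> [A _ //|A B /set_mem[x Ux <-] /set_mem[y Uy <-]|v _].
    rewrite !fE // => eq_phi; apply/(coset_eq _ _ gW).
    rewrite /pre /= piM (piV piM) -phi0 ?groupM ?groupV //.
    have := phiM (pi x * (pi y)^-1) (pi y); rewrite mulgKV eq_phi.
    rewrite groupM ?groupV // => /(_ isT Uy)/eqP.
    by rewrite -subr_eq subrr eq_sym.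
  have [u Uu <-] := phi_surj v; have [x defx] := pi_surj u.
  exists (setmul (pre pi W) [set x]); first by exists x => //; rewrite /pre /= defx.
  by rewrite fE /pre /= defx.
- move=> _ _ [x Ux <-] [y Uy <-]; rewrite (setmul_coset _ _ nW) !fE ?piM ?phiM //.
  by rewrite /pre /= piM groupM.
move=> _ g [x Ux <-]; rewrite setconj_coset // !fE ?(piJ piM) ?phiJ //.
exact: nU.2.
Qed.
End PullBack.

Lemma complemented_dim_le_quotient gamma :
    (forall V : gmodule G, gmod_irreducible V ->
       (exists X Y : set G,
          [/\ open_chief_factor X Y, complemented X Y & gmod_isom_section V X Y]) ->
       exists2 k : nat, endG_dim V k & (k <= gamma)%N) ->
  complemented_dim_le gT gamma.
Proof.
move=> dimG U W p n rho phi p_pr chUW [K [KU KIU]] phiP.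
have [|k /endG_dim_mxcent[b basis_b] lek] := dimG _ (pullback_irreducible chUW phiP).
  exists (pre pi U), (pre pi W); split.
  - exact: pre_chief chUW.
  - exact: (pre_complemented chUW KU KIU).
  - exact: (pre_isom chUW phiP).
by exists k, b.
Qed.
End Dimension.

(* Reduction of the theorem to a finite quotient *)
Local Close Scope group_scope.

Theorem corollary11 (G : topologicalGroupType)
    (prosolvG : prosolvable G) (fgG : top_fin_generated G)
    (dimG : exists gamma : nat, forall V : gmodule G,
       gmod_irreducible V ->
       (exists X Y : set G,
          [/\ open_chief_factor X Y, complemented X Y & gmod_isom_section V X Y]) ->
       exists2 k : nat, endG_dim V k & (k <= gamma)%N) :
  exists beta : nat, forall n : nat, (0 < n)%N ->
    max_intersections G n #<= `I_(n ^ beta)%N.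
Proof.
have [gamma dimV] := dimG; have [S [/finite_seqP[s defS] clS]] := fgG.
exists (meet_exponent gamma (size s)) => n n_gt0.
(* The finite quotient constructed below depends on the chosen family [h], whereas the exponent
   depends only on [gamma] and the number of generators. *)
apply: card_le_ord => k h h_inj max_h.
have /choice[N NP] i : exists N, open_normal N /\ N `<=` h i.
  have [openH indH _] := max_h i.
  by have [N oN sNH] := open_core openH indH; exists N.
have [openN nN] := open_normal_bigcap (fun i => (NP i).1).
set N0 := \bigcap_(i in _) N i in openN nN.
have [gT [pi [piM pi_surj kerE solT]]] :=
  solvable_quotient_morph nN (prosolvG.2 N0 (conj openN nN)).
have open_ker : open [set x | pi x = 1%g].
  by rewrite (_ : [set x | _] = N0) //; apply/seteqP; split=> x /kerE.
have gh i : is_subgroup (h i) by have [[]] := max_h i.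
have kerh i x : pi x = 1%g -> h i x.
  by move=> /kerE Nx; apply: (NP i).2; apply: Nx.
have genT := gen_img piM pi_surj open_ker clS.
have dimT := complemented_dim_le_quotient piM pi_surj open_ker dimV.
have leS : (#|img pi S| <= size s)%N.
  rewrite -(size_map pi); apply: leq_trans (card_size _).
  apply/subset_leq_card/fintype.subsetP=> z /mem_imgP[x].
  by rewrite defS => sx <-; apply: map_f.
apply: leq_trans (card_meet_of_maximals solT genT dimT leS n_gt0).
rewrite -[leqLHS]card_ord -(card_imset (f := fun i => img_group piM (gh i))).
  apply/subset_leq_card/fintype.subsetP=> _ /imsetP[i _ ->]; rewrite finset.inE.
  exact: (img_meet_of_maximals piM pi_surj _ (kerh i) (max_h i)).
(* Each [h i] contains the kernel, so it is recovered from its image. *)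
move=> i j eq_ij; apply: h_inj.
rewrite -(imgK piM (gh i) (kerh i)) -(imgK piM (gh j) (kerh j)).
by congr pre; apply: (congr1 (@gval gT)) eq_ij.
Qed.
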